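(* Let $n$ and $k$ be integers with $0 < k < n$. Let $w = \lfloor n/k \rfloor$ and $x = n \bmod k$, and, when $x>0$, let $y = \lfloor k/x \rfloor$ and $z = k \bmod x$. (a) If $x > 0$ and $z > 0$, then $$m(n) \leq w\, m(n-k)\, m(k) + y\, m(k)^w\, m(x) + \binom{x+z-1}{z} m(n-k)\, m(x)^y + \binom{x+z-1}{x} m(k)^w.$$ (b) If $x > 0$ and $z = 0$, then $$m(n) \leq w\, m(n-k)\, m(k) + y\, m(k)^w\, m(x) + m(n-k)\, m(x)^y.$$ (c) If $x = 0$, then $$m(n) \leq w\, m(n-k)\, m(k) + m(k)^w.$$
   Context: A hypergraph $H=(V,E)$ consists of a finite vertex set $V$ and a set $E$ of subsets of $V$ (hyperedges); it is $n$-uniform if every hyperedge has exactly $n$ vertices. A 2-coloring of $H$ assigns one of two colors (red, blue) to each vertex; it is proper if no hyperedge is monochromatic. $H$ is non-2-colorable if it has no proper 2-coloring. For an integer $n \geq 1$, $m(n)$ denotes the minimum number of hyperedges in a non-2-colorable $n$-uniform hypergraph. Here $a \bmod b$ denotes the remainder in $\{0,\dots,b-1\}$ of $a$ on division by $b$. *)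

(* Defs.v *)
From mathcomp Require Import all_boot.
From mathcomp Require Import boolp.

Set Implicit Arguments.
Unset Strict Implicit.
Unset Printing Implicit Defensive.

(* A hypergraph is given by its finite vertex type V and its set of hyperedges
   E : {set {set V}}; the two colors are the two booleans. *)

Definition uniform (V : finType) (E : {set {set V}}) (n : nat) : Prop :=
  forall e : {set V}, e \in E -> #|e| = n.

Definition monochromatic (V : finType) (c : V -> bool) (e : {set V}) : Prop :=
  exists b : bool, forall v : V, v \in e -> c v = b.

Definition proper_coloring (V : finType) (E : {set {set V}}) (c : V -> bool) :
    Prop :=
  forall e : {set V}, e \in E -> ~ monochromatic c e.

Definition non_two_colorable (V : finType) (E : {set {set V}}) : Prop :=
  ~ exists c : V -> bool, proper_coloring E c.

Definition attained (n r : nat) : Prop :=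
  exists (V : finType) (E : {set {set V}}),
    [/\ uniform E n, non_two_colorable E & #|E| = r].

(* Witness: all the n-subsets of a set with 2n-1 elements. *)
Lemma attained_ex (n : nat) : exists r : nat, `[< attained n r >].
Proof.
pose E := [set e : {set 'I_(n.*2.-1)} | #|e| == n].
exists #|E|; apply/asboolP; exists 'I_(n.*2.-1), E; split=> //.
  by move=> e; rewrite inE => /eqP.
case=> c cP.
have [b hb] : exists b, n <= #|[set v | c v == b]|.
  have h : #|[set v | c v == true]| + #|[set v | c v == false]| = n.*2.-1.
    rewrite -[RHS]card_ord -(cardsC [set v | c v == true]); congr (_ + _).
    by apply: eq_card => v; rewrite !inE; case: (c v).
  have [ht|ht] := leqP n #|[set v | c v == true]|; first by exists true.
  exists false; rewrite leqNgt; apply/negP => hf.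
  have := leq_add ht hf; rewrite addSn addnS h addnn.
  by case: (n) => [|p] //; rewrite doubleS /= ltnn.
have [e /subsetP eS /eqP en] : exists2 e : {set 'I_(n.*2.-1)},
    e \subset [set v | c v == b] & #|e| == n.
  have : 0 < #|[set e : {set 'I_(n.*2.-1)} |
                 e \subset [set v | c v == b] & #|e| == n]|.
    by rewrite cards_draws bin_gt0.
  by case/card_gt0P => e; rewrite inE => /andP[]; exists e.
apply: (cP e); first by rewrite inE en.
by exists b => v /eS; rewrite inE => /eqP.
Qed.

Definition m (n : nat) : nat := ex_minn (attained_ex n).

(* Main.v *)
Require Import Defs.
From mathcomp Require Import all_boot.
From mathcomp Require Import boolp zify.

Set Implicit Arguments.
Unset Strict Implicit.
Unset Printing Implicit Defensive.

(** Take disjoint non-2-colorable hypergraphs: A, which is (n-k)-uniform,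
    B_1, ..., B_w, which are k-uniform, and C_1, ..., C_y, which are x-uniform,
    together with a set D of x+z-1 further vertices. The hyperedges are the unions of
    - an edge of A and an edge of some B_i,
    - an edge of every B_i and an edge of some C_j,
    - an edge of A, an edge of every C_j and a z-subset of D,
    - an edge of every B_i and an x-subset of D.
    If some edge of A is red and no hyperedge is monochromatic, then every B_i
    has a blue edge and every C_j a red edge, so D has fewer than z red and fewer
    than x blue vertices, which is impossible. For z = 0 the number of x-subsets
    of D is 0, and for x = 0 one has z = k and y = 0, so that D has no z-subsets:
    the three bounds are the same one. *)

(** * Monochromatic edges of a prescribed colour *)

Section MonochromaticEdges.

Variable V : finType.
Implicit Types (E : {set {set V}}) (D : {set V}) (c : V -> bool) (b : bool).

Definition has_mono E c b : Prop :=
  exists2 e : {set V}, e \in E & forall v, v \in e -> c v = b.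

(** The positive form in which non-2-colorability is used and proved below; the forward direction is
    classical. *)
Lemma non_two_colorable_mono E :
  non_two_colorable E <-> forall c, exists b, has_mono E c b.
Proof.
split=> [nE c | monoE [c cP]].
  apply: contrapT => no_mono; apply: nE; exists c => e eE [b eb].
  by apply: no_mono; exists b, e.
by have [b [e eE eb]] := monoE c; apply: (cP e eE); exists b.
Qed.

Lemma has_mono_sub E E' c b : E \subset E' -> has_mono E c b -> has_mono E' c b.
Proof. by move=> /subsetP sEE' [e eE eb]; exists e; rewrite ?sEE'. Qed.

(** The hypergraph with the empty set as its only edge is the neutral factor of a join: its edge is
    vacuously of both colours, adds no vertices and leaves edge counts unchanged. *)
Lemma has_mono_set0 c b : has_mono [set set0] c b.
Proof. by exists set0 => [|v]; rewrite inE. Qed.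

Lemma uniform_set0 : uniform [set (set0 : {set V})] 0.
Proof. by move=> e /set1P ->; rewrite cards0. Qed.

Definition subsets_of_card (D : {set V}) r : {set {set V}} :=
  [set e : {set V} | e \subset D & #|e| == r].

Lemma uniform_subsets_of_card D r : uniform (subsets_of_card D r) r.
Proof. by move=> e; rewrite inE => /andP[_ /eqP]. Qed.

Lemma has_mono_subsets_of_card D r c b :
  r <= #|[set v in D | c v == b]| -> has_mono (subsets_of_card D r) c b.
Proof.
rewrite -bin_gt0 -cards_draws => /card_gt0P[e].
rewrite inE => /andP[/subsetP eD er]; exists e => [|v /eD].
  by rewrite inE er andbT; apply/subsetP => v /eD; rewrite inE => /andP[].
by rewrite inE => /andP[_ /eqP].
Qed.

(** Otherwise the two colour classes of [D] would have at most [r - 1] and [s - 1] elements, hence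
    fewer than [#|D|] together. *)
Lemma two_colors_pigeonhole D r s c b : r + s <= #|D|.+1 -> 0 < r + s ->
  has_mono (subsets_of_card D r) c b \/ has_mono (subsets_of_card D s) c (~~ b).
Proof.
move=> le_rs rs0.
have : r <= #|[set v in D | c v == b]| \/ s <= #|[set v in D | c v == ~~ b]|.
  have : #|[set v in D | c v == b]| + #|[set v in D | c v == ~~ b]| = #|D|.
    rewrite -(cardsID [set v | c v == b] D); congr (_ + _); apply: eq_card => v.
      by rewrite !inE.
    by rewrite !inE andbC; case: (c v) b => -[]; rewrite ?andbT ?andbF.
  lia.
by case=> [/has_mono_subsets_of_card|/has_mono_subsets_of_card]; [left|right].
Qed.

End MonochromaticEdges.

(** Brings hypergraphs to a common vertex type; a colouring of [W] is pulled back along [f]. *)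
Lemma embed_hypergraph (V W : finType) (f : V -> W) (E : {set {set V}}) n :
    injective f -> uniform E n -> non_two_colorable E ->
  let E' := [set f @: e | e : {set V} in E] in
  [/\ uniform E' n, non_two_colorable E' & #|E'| = #|E|].
Proof.
move=> f_inj Eu /non_two_colorable_mono monoE; split.
- by move=> _ /imsetP[e eE ->]; rewrite card_imset ?Eu.
- apply/non_two_colorable_mono => c; have [b [e eE eb]] := monoE (c \o f).
  exists b, (f @: e); first exact: imset_f.
  by move=> _ /imsetP[v ve ->]; apply: eb.
- by rewrite card_imset //; apply: imset_inj.
Qed.

(** * Unions of one edge from each hypergraph of a family *)

Section Join.

Variables I V : finType.
Implicit Types E : I -> {set {set V}}.

(** Pairing vertices with [i] gives each [E i] its own copy of [V], so the united edges are disjoint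
    even when the [E i] coincide. *)
Definition join E : {set {set I * V}} :=
  [set [set t : I * V | t.2 \in g t.1] |
    g : {ffun I -> {set V}} in family (fun i => mem (E i))].

Lemma card_join E : #|join E| <= \prod_i #|E i|.
Proof.
apply: leq_trans (leq_imset_card _ _) _.
by rewrite card_family foldrE big_image.
Qed.

Lemma uniform_join E (s : I -> nat) :
  (forall i, uniform (E i) (s i)) -> uniform (join E) (\sum_i s i).
Proof.
move=> Eu _ /imsetP[g /familyP gE ->].
rewrite -sum1dep_card -(pair_big_dep xpredT (fun i v => v \in g i)
  (fun _ _ => 1)) /=.
by apply: eq_bigr => i _; rewrite sum1_card (Eu i) ?gE.
Qed.

Lemma has_mono_join E (c : I * V -> bool) b :
  (forall i, has_mono (E i) (fun v => c (i, v)) b) -> has_mono (join E) c b.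
Proof.
move=> /fin_all_exists2[g gE gb].
exists [set t : I * V | t.2 \in g t.1].
  apply/imsetP; exists (finfun g); first by apply/familyP => i; rewrite ffunE gE.
  by apply/setP => t; rewrite !inE ffunE.
by case=> i v; rewrite inE => /gb.
Qed.

End Join.

Lemma m_attained n : attained n (m n).
Proof. by rewrite /m; case: ex_minnP => r /asboolP. Qed.

Lemma m_le (V : finType) (E : {set {set V}}) n :
  uniform E n -> non_two_colorable E -> m n <= #|E|.
Proof.
move=> Eu nE; rewrite /m; case: ex_minnP => r _; apply.
by apply/asboolP; exists V, E.
Qed.

Lemma card_bigcup_const (T : finType) n (F : 'I_n -> {set T}) r :
  (forall i, #|F i| <= r) -> #|\bigcup_i F i| <= n * r.
Proof.
move=> Fr; apply: (@leq_trans (\sum_(i < n) #|F i|)).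
  elim/big_rec2: _ => [|i s U _ le_Us]; first by rewrite cards0.
  by apply: leq_trans (leq_card_setU _ _) _; rewrite leq_add2l.
by rewrite -[X in X * r]card_ord -sum_nat_const; apply: leq_sum.
Qed.

(** * The hypergraph with four kinds of edges *)

Section Construction.

Variables (w y : nat) (V : finType).

(** The indices are [w] copies for the B_i, [y] for the C_j, [true] for A and [false] for D. Being
    polymorphic, the pattern serves for edge sets, edge sizes and edge counts alike. *)
Definition parts (X : Type) (a d : X) (b : 'I_w -> X) (c : 'I_y -> X)
    (i : 'I_w + 'I_y + bool) : X :=
  match i with
  | inl (inl j) => b j
  | inl (inr j) => c j
  | inr true => a
  | inr false => d
  end.

Lemma sum_parts a d b c :
  \sum_i parts a d b c i = \sum_j b j + \sum_j c j + (a + d).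
Proof. by rewrite !big_sumType big_bool. Qed.

Lemma prod_parts a d b c :
  \prod_i parts a d b c i = (\prod_j b j) * (\prod_j c j) * (a * d).
Proof. by rewrite !big_sumType big_bool. Qed.

(** Selects a single B_i or C_j: [x0] is the neutral value, namely 0 for sizes, 1 for counts and the
    hypergraph with one empty edge for edge sets. *)
Definition only (X : Type) (n : nat) (x0 x : X) (j i : 'I_n) : X :=
  if i == j then x else x0.

Lemma sum_only n (x : nat) (j : 'I_n) : \sum_i only 0 x j i = x.
Proof. by rewrite -big_mkcond big_pred1_eq. Qed.

Lemma prod_only n (x : nat) (j : 'I_n) : \prod_i only 1 x j i = x.
Proof. by rewrite -big_mkcond big_pred1_eq. Qed.

Implicit Types A D : {set {set V}}.

Definition join_parts A D B C : {set {set ('I_w + 'I_y + bool) * V}} :=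
  join (parts A D B C).

Lemma card_join_parts A D B C :
  #|join_parts A D B C| <=
    (\prod_j #|B j|) * (\prod_j #|C j|) * (#|A| * #|D|).
Proof.
rewrite -prod_parts; apply: leq_trans (card_join _) _.
by apply: leq_prod => -[[j|j]|[]] _.
Qed.

Lemma uniform_join_parts A D B C a d b c :
    uniform A a -> uniform D d ->
    (forall j, uniform (B j) (b j)) -> (forall j, uniform (C j) (c j)) ->
  uniform (join_parts A D B C) (\sum_j b j + \sum_j c j + (a + d)).
Proof.
move=> Aa Dd Bb Cc; rewrite -sum_parts.
by apply: uniform_join => -[[j|j]|[]] /=.
Qed.

Lemma has_mono_join_parts A D B C f b :
    has_mono A (fun v => f (inr true, v)) b ->
    has_mono D (fun v => f (inr false, v)) b ->
    (forall j, has_mono (B j) (fun v => f (inl (inl j), v)) b) ->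
    (forall j, has_mono (C j) (fun v => f (inl (inr j), v)) b) ->
  has_mono (join_parts A D B C) f b.
Proof. by move=> *; apply: has_mono_join => -[[j|j]|[]] /=. Qed.

Lemma m_le_construction (EA EB EC : {set {set V}}) (S : {set V}) p k x z :
    uniform EA p -> uniform EB k -> uniform EC x ->
    non_two_colorable EA -> non_two_colorable EB -> non_two_colorable EC ->
    #|S| = x + z - 1 -> 0 < x + z -> p + k = w * k + x -> k = y * x + z ->
  m (p + k) <= w * #|EA| * #|EB| + y * #|EB| ^ w * #|EC|
               + 'C(x + z - 1, z) * #|EA| * #|EC| ^ y
               + 'C(x + z - 1, x) * #|EB| ^ w.
Proof.
move=> Au Bu Cu /non_two_colorable_mono nA /non_two_colorable_mono nB.
move=> /non_two_colorable_mono nC cardS xz0 pk kyxz.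
pose O : {set {set V}} := [set set0].
have Ou : uniform O 0 := @uniform_set0 V.
(* [F1] to [F4] are the four kinds of edges in the order of the overview; [O] fills each part that
   an edge does not meet. *)
pose F1 := \bigcup_(i < w) join_parts EA O (only O EB i) (fun=> O).
pose F2 := \bigcup_(j < y) join_parts O O (fun=> EB) (only O EC j).
pose F3 := join_parts EA (subsets_of_card S z) (fun=> O) (fun=> EC).
pose F4 := join_parts O (subsets_of_card S x) (fun=> EB) (fun=> O).
have cardO : #|O| = 1 by rewrite cards1.
have only_card n (E : {set {set V}}) (j : 'I_n) :
    \prod_i #|only O E j i| = #|E|.
  rewrite -[RHS](prod_only _ j); apply: eq_bigr => i _.
  by rewrite /only; case: ifP.
have only_uniform n (E : {set {set V}}) r (j i : 'I_n) :
    uniform E r -> uniform (only O E j i) (only 0 r j i).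
  by rewrite /only; case: ifP.
have card1 : #|F1| <= w * #|EA| * #|EB|.
  rewrite -mulnA; apply: card_bigcup_const => i.
  apply: leq_trans (card_join_parts _ _ _ _) _.
  by rewrite only_card prod_nat_const cardO exp1n !muln1 mulnC.
have card2 : #|F2| <= y * #|EB| ^ w * #|EC|.
  rewrite -mulnA; apply: card_bigcup_const => j.
  apply: leq_trans (card_join_parts _ _ _ _) _.
  by rewrite only_card prod_nat_const cardO card_ord !muln1.
have card3 : #|F3| <= 'C(x + z - 1, z) * #|EA| * #|EC| ^ y.
  apply: leq_trans (card_join_parts _ _ _ _) _.
  rewrite !prod_nat_const cardO !card_ord exp1n cards_draws cardS.
  by apply/eq_leq; lia.
have card4 : #|F4| <= 'C(x + z - 1, x) * #|EB| ^ w.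
  apply: leq_trans (card_join_parts _ _ _ _) _.
  rewrite !prod_nat_const cardO !card_ord exp1n cards_draws cardS.
  by apply/eq_leq; lia.
pose F := F1 :|: F2 :|: F3 :|: F4.
have cardF : #|F| <= #|F1| + #|F2| + #|F3| + #|F4|.
  do 3!(apply: leq_trans (leq_card_setU _ _) _; rewrite leq_add2r).
  by [].
apply: leq_trans (leq_trans cardF _); last by rewrite !leq_add.
apply: m_le => [e|].
  (* The edge sizes are [k + p], [w * k + x], [y * x + p + z] and [w * k + x]; all equal [p + k] by
     [pk] and [kyxz]. *)
  rewrite !inE => /orP[/orP[/orP[]|]|].
  - case/bigcupP => i _ /(uniform_join_parts Au Ou
      (fun l => only_uniform _ _ _ i l Bu) (fun=> Ou)) ->.
    by rewrite sum_only sum_nat_const; lia.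
  - case/bigcupP => j _ /(uniform_join_parts Ou Ou (fun=> Bu)
      (fun l => only_uniform _ _ _ j l Cu)) ->.
    by rewrite sum_only sum_nat_const card_ord; lia.
  - move/(uniform_join_parts Au (@uniform_subsets_of_card V S z)
      (fun=> Ou) (fun=> Cu)) ->.
    by rewrite !sum_nat_const !card_ord; lia.
  - move/(uniform_join_parts Ou (@uniform_subsets_of_card V S x)
      (fun=> Bu) (fun=> Ou)) ->.
    by rewrite !sum_nat_const !card_ord; lia.
have other E (c : V -> bool) b : (exists b', has_mono E c b') ->
    ~ has_mono E c b -> has_mono E c (~~ b).
  by case=> b'; case: b b' => -[].
have monoO c b : has_mono O c b := has_mono_set0 c b.
(* There is one colouring [c i] per copy, since [f] may colour the copies of the same hypergraph
   differently. *)
have only_mono n (E : {set {set V}}) c b (j : 'I_n) :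
    has_mono E (c j) b -> forall i, has_mono (only O E j i) (c i) b.
  by move=> Eb i; rewrite /only; case: eqP => // ->.
apply/non_two_colorable_mono => f; apply: contrapT => noF.
have no_mono b (E : {set {set ('I_w + 'I_y + bool) * V}}) : E \subset F ->
    ~ has_mono E f b.
  by move=> sEF Eb; apply: noF; exists b; apply: has_mono_sub Eb.
have sub1 : F1 \subset F by rewrite /F -!setUA subsetUl.
have sub2 : F2 \subset F by rewrite /F -setUA (setUC F1) -!setUA subsetUl.
have sub3 : F3 \subset F by rewrite /F (setUC _ F3) -!setUA subsetUl.
have sub4 : F4 \subset F by rewrite subsetUr.
have [b Ab] := nA (fun v => f (inr true, v)).
(* An edge of colour [b] here would join with the one of A to a monochromatic edge in [F1]. *)
have Bb j : has_mono EB (fun v => f (inl (inl j), v)) (~~ b).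
  apply: other => // Bjb; apply: (no_mono b _ sub1).
  apply: (has_mono_sub (bigcup_sup j isT)).
  apply: has_mono_join_parts => //.
  exact: (only_mono _ _ (fun i v => f (inl (inl i), v))).
(* An edge of colour [~~ b] here would join with those of all the B_i to a monochromatic edge in
   [F2]. *)
have Cb j : has_mono EC (fun v => f (inl (inr j), v)) b.
  rewrite -[b]negbK; apply: other => // Cjb; apply: (no_mono (~~ b) _ sub2).
  apply: (has_mono_sub (bigcup_sup j isT)).
  apply: has_mono_join_parts => //.
  exact: (only_mono _ _ (fun i v => f (inl (inr i), v))).
have leS : z + x <= #|S|.+1 by rewrite cardS; lia.
have zx0 : 0 < z + x by rewrite addnC.
(* Either [z] vertices of colour [b] complete an edge in [F3], or [x] vertices of colour [~~ b]
   complete one in [F4]. *)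
have [Sb|Sb] := two_colors_pigeonhole (fun v => f (inr false, v)) b leS zx0.
- exact: (no_mono b _ sub3 (has_mono_join_parts Ab Sb _ Cb)).
- exact: (no_mono (~~ b) _ sub4 (has_mono_join_parts _ Sb Bb _)).
Qed.

End Construction.

(** Minimal hypergraphs for [p], [k] and [x] are placed in separate summands of one vertex type,
    whose last summand supplies the set D. Here [p] stands for [n - k], which avoids truncated
    subtraction. *)
Lemma m_le_unified w y p k x z :
    0 < x + z -> p + k = w * k + x -> k = y * x + z ->
  m (p + k) <= w * m p * m k + y * m k ^ w * m x
               + 'C(x + z - 1, z) * m p * m x ^ y
               + 'C(x + z - 1, x) * m k ^ w.
Proof.
move=> xz0 pk kyxz.
have [VA [A [Au nA <-]]] := m_attained p.
have [VB [B [Bu nB <-]]] := m_attained k.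
have [VC [C [Cu nC <-]]] := m_attained x.
pose V : finType := (VA + VB + (VC + 'I_(x + z - 1)))%type.
have [|Au' nA' <-] := @embed_hypergraph _ V (inl \o inl) A p _ Au nA.
  exact: inj_comp inl_inj inl_inj.
have [|Bu' nB' <-] := @embed_hypergraph _ V (inl \o inr) B k _ Bu nB.
  exact: inj_comp inl_inj inr_inj.
have [|Cu' nC' <-] := @embed_hypergraph _ V (inr \o inl) C x _ Cu nC.
  exact: inj_comp inr_inj inl_inj.
have cardS : #|[set (inr (inr i) : V) | i : 'I_(x + z - 1)]| = x + z - 1.
  by rewrite card_imset ?card_ord // => i j [].
exact: m_le_construction Au' Bu' Cu' nA' nB' nC' cardS xz0 pk kyxz.
Qed.

Theorem mainTheorem2 (n k : nat) (hk : 0 < k) (hkn : k < n) :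
  let w := n %/ k in
  let x := n %% k in
  let y := k %/ x in
  let z := k %% x in
  [/\ (0 < x -> 0 < z ->
        m n <= w * m (n - k) * m k + y * m k ^ w * m x
               + 'C(x + z - 1, z) * m (n - k) * m x ^ y
               + 'C(x + z - 1, x) * m k ^ w),
      (0 < x -> z = 0 ->
        m n <= w * m (n - k) * m k + y * m k ^ w * m x
               + m (n - k) * m x ^ y)
    & (x = 0 ->
        m n <= w * m (n - k) * m k + m k ^ w)].
Proof.
move=> w x y z.
(* This includes [x = 0], where by convention [k %/ 0 = 0] and [k %% 0 = k]. *)
have kyxz : k = y * x + z by exact: divn_eq.
have nkx : n - k + k = w * k + x by rewrite subnK ?(ltnW hkn) //; exact: divn_eq.
have xz0 : 0 < x + z.
  by rewrite lt0n addn_eq0; apply/andP => -[/eqP x0 /eqP z0]; lia.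
have := m_le_unified xz0 nkx kyxz; rewrite subnK ?(ltnW hkn) // => bound.
split=> [//|x0 z0|x0].
- move: bound; rewrite z0 addn0 bin0 mul1n bin_small ?subn1 ?prednK //.
  by rewrite mul0n addn0.
- have y0 : y = 0 by rewrite /y x0.
  move: bound; rewrite x0 y0 add0n bin0 bin_small; last by lia.
  by rewrite !mul0n !addn0 mul1n.
Qed.
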